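(* Let $\mathcal{S}$ be a numerical semigroup with embedding dimension three and let $A$ be its minimal generating set. Then $I_A$ is generated by circuits if and only if there exist pairwise coprime positive integers $d_1,d_2,d_3$ and $f_2,f_3\in\mathbb{Z}^+$ such that $\gcd(d_2,f_2)=\gcd(d_3,f_3)=1$ and $\mathcal{S}$ is (minimally) generated by $\{d_2d_3,\ f_2d_1d_3,\ f_3d_1d_2\}$.
   Context: $\mathbb{K}$ is an arbitrary field and $\mathbb{N}$ contains $0$. A numerical semigroup is a submonoid of $\mathbb{N}$ generated by a finite set of positive integers with greatest common divisor $1$; its minimal generating set is its unique generating set no proper subset of which generates it, and its embedding dimension is the cardinality of its minimal generating set. For $A=\{a_1,\ldots,a_n\}$, the $A$-degree of $\mathbf{x}^{\mathbf{u}}=x_1^{u_1}\cdots x_n^{u_n}$ is $u_1a_1+\cdots+u_na_n$, and the toric ideal of $A$ is $I_A=\langle \mathbf{x}^{\mathbf{u}}-\mathbf{x}^{\mathbf{v}}\mid \deg_A(\mathbf{x}^{\mathbf{u}})=\deg_A(\mathbf{x}^{\mathbf{v}})\rangle\subseteq\mathbb{K}[x_1,\ldots,x_n]$. A binomial $\mathbf{x}^{\mathbf{u}}-\mathbf{x}^{\mathbf{v}}\in I_A$ is irreducible if $\operatorname{supp}(\mathbf{u})\cap\operatorname{supp}(\mathbf{v})=\emptyset$ (where $\operatorname{supp}(\mathbf{u})=\{i\mid u_i\ne0\}$) and the nonzero entries of $\mathbf{u}+\mathbf{v}$ are relatively prime; a circuit is an irreducible binomial of $I_A$ whose support $\operatorname{supp}(\mathbf{u})\cup\operatorname{supp}(\mathbf{v})$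 is inclusion-minimal among nonzero binomials of $I_A$. Equivalently, the set of circuits is $\mathcal{C}_A=\{x_i^{a_j/\gcd(a_i,a_j)}-x_j^{a_i/\gcd(a_i,a_j)}\mid i\neq j\}$. ''$I_A$ is generated by circuits'' means $I_A=\langle\mathcal{C}_A\rangle$. *)

(* Defs.v *)
From HB Require Import structures.
From mathcomp Require Import all_boot all_order all_algebra.
From mathcomp Require Import finmap mpoly.

Set Implicit Arguments.
Unset Strict Implicit.
Unset Printing Implicit Defensive.

Import GRing.Theory.

Definition monoid_span (A : {fset nat}) (s : nat) : Prop :=
  exists c : nat -> nat, s = \sum_(x <- A) c x * x.

Definition generates (A : {fset nat}) (S : nat -> Prop) : Prop :=
  forall s, S s <-> monoid_span A s.

Definition numerical_semigroup (S : nat -> Prop) : Prop :=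
  exists A : {fset nat},
    [/\ forall x, x \in A -> 0 < x,
        \big[gcdn/0]_(x <- A) x = 1
      & generates A S].

Definition minimal_generating_set (S : nat -> Prop) (A : {fset nat}) : Prop :=
  generates A S /\ forall B : {fset nat}, (B `<` A)%fset -> ~ generates B S.

(* The minimal generating set is unique, so at most one n qualifies. *)
Definition has_embedding_dimension (S : nat -> Prop) (n : nat) : Prop :=
  exists2 A : {fset nat}, minimal_generating_set S A & #|` A|%fset = n.

(* The variables are numbered by a repetition-free listing a of the set A. *)
Definition enumerates (n : nat) (a : n.-tuple nat) (A : {fset nat}) : Prop :=
  uniq a /\ A =i a.

Section ToricIdeal.
Variables (K : fieldType) (n : nat).
Implicit Types (p : {mpoly K[n]}) (u v : 'X_{1..n}).

Definition ideal_span (G : {mpoly K[n]} -> Prop) (p : {mpoly K[n]}) : Prop :=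
  exists s : seq ({mpoly K[n]} * {mpoly K[n]}),
    (forall cg, cg \in s -> G cg.2) /\ p = (\sum_(cg <- s) cg.1 * cg.2)%R.

Definition binomial u v : {mpoly K[n]} := ('X_[u] - 'X_[v])%R.

Definition supp u : {set 'I_n} := [set i | u i != 0].

Definition binomial_supp u v : {set 'I_n} := supp u :|: supp v.

Variable a : n.-tuple nat.

Definition adeg u : nat := \sum_(i < n) u i * tnth a i.

Definition toric_ideal : {mpoly K[n]} -> Prop :=
  ideal_span (fun p => exists u v, p = binomial u v /\ adeg u = adeg v).

(* Zero entries do not affect the gcd, and the gcd is 0 when u = v = 0, so the
   zero binomial is not irreducible. *)
Definition irreducible_binomial u v : Prop :=
  [/\ toric_ideal (binomial u v),
      [disjoint supp u & supp v]
    & \big[gcdn/0]_(i < n) (u i + v i) = 1].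

Definition circuit p : Prop :=
  exists u v,
    [/\ p = binomial u v,
        irreducible_binomial u v
      & forall u' v', binomial u' v' <> 0%R -> toric_ideal (binomial u' v') ->
          ~~ (binomial_supp u' v' \proper binomial_supp u v)].

Definition generated_by_circuits : Prop :=
  forall p, toric_ideal p <-> ideal_span circuit p.

End ToricIdeal.

(* Main.v *)
Require Import Defs.
From HB Require Import structures.
From mathcomp Require Import all_boot all_order all_algebra.
From mathcomp Require Import finmap mpoly.
From mathcomp Require Import zify ring.

(** Write [a_1, a_2, a_3] for the generators, [lcm_ij] and [gcd_ij] for the lcm
    and gcd of [a_i] and [a_j].  The proof passes through the condition that, in
    some numbering of the generators, [a_1 = gcd_12 * gcd_13].  As the generators
    have gcd 1, this is the same as the parametrisation: take [d_2 = gcd_13],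
    [d_3 = gcd_12] and [d_1 = 1] one way ([generated_by_circuits_gcd] and the
    final proof).

    Circuits generate when [A] is so parametrised
    ([gluing_generated_by_circuits]).  The two circuits
    [x_1^(f_2 d_1) - x_2^(d_2)] and [x_1^(f_3 d_1) - x_3^(d_3)] reduce every
    monomial to one whose exponents of [x_2] and [x_3] are below [d_2] and [d_3].
    Among the monomials of a given degree only one is reduced: modulo [d_2] the
    degree determines the exponent of [x_2], modulo [d_3] that of [x_3], and then
    the exponent of [x_1] is forced.

    Conversely, suppose that circuits generate.  Setting all variables but [x_i]
    to zero turns a binomial [x_i^m - x^u], with [x_i] not in [x^u], into [x_i^m],
    and turns each circuit into zero or, up to sign, into a power of [x_i] of
    [A]-degree at least the least [lcm_ij].  Hence whenever the others represent a
    positive multiple [m a_i], some [lcm_ij] is at most [m a_i]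
    ([circuits_min_relation]).
    Number the generators so that [lcm_23] is the largest of the three lcms; then
    [lcm_12] is the least positive multiple of [a_2] represented by the other two,
    and [lcm_13] that of [a_3].  This forces [a_1 = gcd_12 * gcd_13]
    ([eq_mul_gcdn]): [gcd_12 * a_3] is an integer combination of [a_1] and [a_2],
    which, written with a small nonnegative coefficient of [a_2], contradicts the
    first minimality if its coefficient of [a_1] is negative, and otherwise gives
    [a_1 <= gcd_12 * gcd_13] by the second one. *)

Set Implicit Arguments.
Unset Strict Implicit.
Unset Printing Implicit Defensive.

Import GRing.Theory.

(* The binomial coefficient of the same name would otherwise take precedence. *)
Local Notation binomial := Defs.binomial.

(** * Ideals spanned by a set of polynomials *)

Section IdealSpan.
Variables (K : fieldType) (n : nat).
Implicit Types (G H : {mpoly K[n]} -> Prop) (p q c : {mpoly K[n]}).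
Implicit Types (u v w : 'X_{1..n}).
Local Open Scope ring_scope.

Lemma ideal_span_gen G p : G p -> ideal_span G p.
Proof.
move=> Gp; exists [:: (1, p)]; split; last by rewrite big_seq1 mul1r.
by move=> cg; rewrite inE => /eqP ->.
Qed.

Lemma ideal_span0 G : ideal_span G 0.
Proof. by exists [::]; split; rewrite ?big_nil. Qed.

Lemma ideal_spanD G p q : ideal_span G p -> ideal_span G q -> ideal_span G (p + q).
Proof.
move=> [s [sG ->]] [t [tG ->]]; exists (s ++ t); split; last by rewrite big_cat.
by move=> cg; rewrite mem_cat => /orP[/sG|/tG].
Qed.

Lemma ideal_spanM G c p : ideal_span G p -> ideal_span G (c * p).
Proof.
move=> [s [sG ->]]; exists [seq (c * cg.1, cg.2) | cg <- s]; split.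
  by move=> _ /mapP[cg /sG Gcg ->].
rewrite big_map mulr_sumr; apply: eq_bigr => cg _; exact: mulrA.
Qed.

Lemma ideal_span_ind G (P : {mpoly K[n]} -> Prop) :
  P 0 -> (forall p q, P p -> P q -> P (p + q)) ->
  (forall c g, G g -> P (c * g)) -> forall p, ideal_span G p -> P p.
Proof.
move=> P0 PD PM p [s [sG ->]]; rewrite big_seq.
by apply: (big_ind P) => // cg /sG; apply: PM.
Qed.

Lemma ideal_span_sub G H p :
  (forall g, G g -> ideal_span H g) -> ideal_span G p -> ideal_span H p.
Proof.
move=> GH; apply: ideal_span_ind => [|q r|c g /GH]; first exact: ideal_span0.
  exact: ideal_spanD.
exact: ideal_spanM.
Qed.

(** Exponents whose monomials agree modulo the ideal spanned by [G]; on these,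
    reduction to a normal form is a computation in a congruence on exponent
    vectors rather than in the quotient ring. *)
Definition congruent G u v := ideal_span G (binomial K u v).

Lemma congruent_refl G u : congruent G u u.
Proof. by rewrite /congruent /binomial subrr; apply: ideal_span0. Qed.

Lemma congruent_sym G u v : congruent G u v -> congruent G v u.
Proof.
move=> Guv; rewrite /congruent /binomial -opprB -mulN1r.
exact: ideal_spanM.
Qed.

Lemma congruent_trans G u v w : congruent G u v -> congruent G v w -> congruent G u w.
Proof.
move=> Guv Gvw; have := ideal_spanD Guv Gvw.
by rewrite /binomial addrA subrK.
Qed.

Lemma congruentDr G w u v : congruent G u v -> congruent G (u + w) (v + w).
Proof.
move=> /(ideal_spanM 'X_[w]); rewrite /congruent /binomial.
by rewrite mulrBr -!mpolyXD ![(w + _)%MM]addmC.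
Qed.

Lemma congruentD G u v u' v' :
  congruent G u v -> congruent G u' v' -> congruent G (u + u') (v + v').
Proof.
move=> Guv Guv'; apply: (@congruent_trans _ _ (v + u')%MM).
  exact: congruentDr.
rewrite ![(v + _)%MM]addmC; exact: congruentDr.
Qed.

Lemma congruentMn G u v k : congruent G u v -> congruent G (u *+ k) (v *+ k).
Proof.
move=> Guv; elim: k => [|k IHk]; first by rewrite !mulm0n; apply: congruent_refl.
by rewrite !mulmS; apply: congruentD.
Qed.

(** Division with remainder of the exponent of one variable, by a binomial that
    trades its [q]-th power for a power of another variable. *)
Lemma congruent_divn G (i j : 'I_n) (p q m : nat) :
  congruent G (U_(i) *+ p) (U_(j) *+ q) ->
  congruent G (U_(j) *+ m) (U_(i) *+ (m %/ q * p) + U_(j) *+ (m %% q)).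
Proof.
move=> /congruent_sym/(congruentMn (m %/ q))/(congruentDr (U_(j) *+ (m %% q))).
congr (congruent G _ _); apply/mnmP => l; rewrite !mnmDE !mulmnE; last by ring.
by rewrite [in RHS](divn_eq m q); ring.
Qed.

End IdealSpan.

(** * Toric ideals and circuits *)

Section Toric.
Variables (K : fieldType) (n : nat) (a : n.-tuple nat).
Implicit Types (u v w : 'X_{1..n}).

Lemma adegD u v : adeg a (u + v) = adeg a u + adeg a v.
Proof.
rewrite /adeg -big_split; apply: eq_bigr => i _.
by rewrite mnmDE mulnDl.
Qed.

Lemma adegU (i : 'I_n) m : adeg a (U_(i) *+ m) = m * tnth a i.
Proof.
rewrite /adeg (bigD1 i) //= big1 => [|j ji].
  by rewrite mulmnE mnm1E eqxx mul1n addn0.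
by rewrite mulmnE mnm1E eq_sym (negPf ji).
Qed.

Lemma toric_binomial u v : adeg a u = adeg a v -> toric_ideal a (binomial K u v).
Proof. by move=> uv; apply: ideal_span_gen; exists u, v. Qed.

Definition degree_eval (p : {mpoly K[n]}) : {poly K} :=
  mmap (@polyC K) (fun i => 'X^(tnth a i))%R p.

Lemma degree_evalD : {morph degree_eval : p q / p + q >-> p + q}%R.
Proof. exact: rmorphD. Qed.

Lemma degree_evalM : {morph degree_eval : p q / p * q >-> p * q}%R.
Proof. exact: rmorphM. Qed.

Lemma degree_evalB : {morph degree_eval : p q / p - q >-> p - q}%R.
Proof. exact: rmorphB. Qed.

Lemma degree_evalX u : degree_eval 'X_[u] = ('X^(adeg a u))%R.
Proof.
rewrite /degree_eval mmapX /mmap1 /adeg.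
rewrite (big_morph (fun m => ('X^m : {poly K})%R) (exprD _) (expr0 _)).
by apply: eq_bigr => i _; rewrite mulnC exprM.
Qed.

(** The toric ideal lies in the kernel of the substitution of ['X^(a_i)] for the
    [i]-th variable, which sends a monomial to a power of ['X] recording its degree. *)
Lemma toric_binomialP u v : toric_ideal a (binomial K u v) <-> adeg a u = adeg a v.
Proof.
split=> [|]; last exact: toric_binomial.
move=> uvI; have: degree_eval (binomial K u v) = 0%R.
  move: (binomial K u v) uvI; apply: ideal_span_ind => [|p q p0 q0|c g].
  - exact: rmorph0.
  - by rewrite degree_evalD p0 q0 addr0.
  move=> [u' [v' [-> uv']]]; rewrite degree_evalM degree_evalB.
  by rewrite !degree_evalX uv' subrr mulr0.
rewrite degree_evalB !degree_evalX => /eqP.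
rewrite subr_eq0 => /eqP/(congr1 (fun p : {poly K} => size p)).
by rewrite !size_polyXn => -[].
Qed.

Hypothesis a_gt0 : forall i, 0 < tnth a i.

Lemma adeg_ge u i : u i * tnth a i <= adeg a u.
Proof. by rewrite /adeg (bigD1 i) //= leq_addr. Qed.

Lemma adeg_eq0 u : adeg a u = 0 -> u = 0%MM.
Proof.
move=> u0; apply/mnmP => i; rewrite mnm0E; apply/eqP.
by have := adeg_ge u i; rewrite u0 leqn0 muln_eq0 [_ == 0 in X in _ || X]gtn_eqF ?orbF.
Qed.

Lemma adeg_supp1 u i : (forall j, j != i -> u j = 0) -> adeg a u = u i * tnth a i.
Proof.
by move=> u0; rewrite /adeg (bigD1 i) //= big1 ?addn0 // => j /u0->.
Qed.

(** On a single variable the degree determines the exponent. *)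
Lemma toric_supp1 u v i : toric_ideal a (binomial K u v) ->
  binomial_supp u v \subset [set i] -> binomial K u v = 0%R.
Proof.
move=> /toric_binomialP uv /subsetP sub.
have out j : j != i -> u j = 0 /\ v j = 0.
  move=> ji; have := contraNN (sub j); rewrite !inE ji => /(_ isT).
  by rewrite negb_or !negbK => /andP[/eqP-> /eqP->].
suff -> : u = v by rewrite /binomial subrr.
apply/mnmP => j; have [->|/out[-> ->] //] := eqVneq j i.
move: uv; rewrite !(@adeg_supp1 _ i); [|by move=> k /out[]..].
by move/eqP; rewrite eqn_pmul2r // => /eqP.
Qed.

Lemma pair_supp (i j : 'I_n) p q :
  binomial_supp (U_(i) *+ p) (U_(j) *+ q) \subset [set i; j].
Proof.
apply/subsetP => l; rewrite !inE !mulmnE !mnm1E ![_ == l]eq_sym.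
by case: (l == i); case: (l == j); rewrite // !mul0n.
Qed.

Lemma binomial_neq0 u v : u != v -> binomial K u v <> 0%R.
Proof.
move=> uv /(congr1 (mcoeff u)); rewrite mcoeffB !mcoeffX mcoeff0 eqxx.
by rewrite eq_sym (negPf uv) subr0 => /eqP; rewrite oner_eq0.
Qed.

(** The support is minimal by [toric_supp1]: properly inside a set of two
    variables there is no room for the support of a nonzero toric binomial. *)
Lemma circuit_pair i j p q : i != j -> p * tnth a i = q * tnth a j -> coprime p q ->
  circuit a (binomial K (U_(i) *+ p) (U_(j) *+ q)).
Proof.
move=> ij pq co; have ijF := negPf ij; have jiF : (j == i) = false by rewrite eq_sym.
exists (U_(i) *+ p)%MM, (U_(j) *+ q)%MM; split=> //.
  split.
  - by apply: toric_binomial; rewrite !adegU.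
  - rewrite disjoint_subset; apply/subsetP => k; rewrite !inE !mulmnE !mnm1E.
    case: (eqVneq i k) => [<-|_]; last by rewrite mul0n.
    by rewrite jiF mul0n.
  apply/eqP; rewrite -dvdn1 -(eqP co) dvdn_gcd.
  apply/andP; split.
    apply: (@biggcdn_inf _ i) => //; rewrite !mulmnE !mnm1E eqxx jiF.
    by rewrite mul1n mul0n addn0.
  apply: (@biggcdn_inf _ j) => //; rewrite !mulmnE !mnm1E eqxx ijF.
  by rewrite mul1n mul0n add0n.
move=> u v uv0 uvI; apply/negP => /properP[sub [k kij kuv]].
apply: uv0; apply: (toric_supp1 (i := if k == i then j else i)) => //.
apply/subsetP => m muv; rewrite inE.
have mk : m != k by apply: contraNneq kuv => <-.
case/set2P: (subsetP (pair_supp i j p q) _ kij) => kE;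
  case/set2P: (subsetP (pair_supp i j p q) _ (subsetP sub _ muv)) => mE.
- by rewrite kE mE eqxx in mk.
- by rewrite kE mE !eqxx.
- by rewrite kE mE jiF.
- by rewrite kE mE eqxx in mk.
Qed.

Lemma circuit_toric p : ideal_span (circuit a) p -> toric_ideal (K := K) a p.
Proof.
by apply: ideal_span_sub => _ [u [v [-> [uvI _ _] _]]].
Qed.

Lemma generated_by_circuitsP :
  (forall u v, adeg a u = adeg a v -> congruent (circuit (K := K) a) u v) ->
  generated_by_circuits K a.
Proof.
move=> gen p; split; last exact: circuit_toric.
by apply: ideal_span_sub => _ [u [v [-> /gen]]].
Qed.

End Toric.

(** * Relations forced by generation by circuits *)

Section Specialisation.
Variables (K : fieldType) (n : nat) (a : n.-tuple nat).
Hypothesis a_gt0 : forall i, 0 < tnth a i.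
Implicit Types (u v : 'X_{1..n}).

Definition specialise (i : 'I_n) (p : {mpoly K[n]}) : {poly K} :=
  mmap (@polyC K) (fun j => if j == i then 'X else 0)%R p.

Lemma specialiseD i : {morph specialise i : p q / p + q >-> p + q}%R.
Proof. exact: rmorphD. Qed.

Lemma specialiseM i : {morph specialise i : p q / p * q >-> p * q}%R.
Proof. exact: rmorphM. Qed.

Lemma specialiseB i : {morph specialise i : p q / p - q >-> p - q}%R.
Proof. exact: rmorphB. Qed.

Lemma specialiseX i u :
  specialise i 'X_[u] = (if [forall (j | j != i), u j == 0] then 'X^(u i) else 0)%R.
Proof.
rewrite /specialise mmapX /mmap1 (bigD1 i) //= eqxx.
case: ifP => [/forall_inP u0|/negbT].
  by rewrite big1 ?mulr1 // => j ji; rewrite (eqP (u0 j ji)) expr0.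
rewrite negb_forall_in => /exists_inP[j ji uj].
by rewrite (bigD1 j) //= (negPf ji) expr0n (negPf uj) mul0r mulr0.
Qed.

(** A monomial of a circuit survives the specialisation only if it is a power of
    the [i]-th variable.  The other monomial then involves some variable [j], and no
    further one, since there is already a toric binomial in variables [i] and [j]
    alone.  The common degree is thus a multiple of both generators. *)
Lemma circuit_monomial_low i m u v :
  (forall j, j != i -> m * tnth a i < lcmn (tnth a i) (tnth a j)) ->
  irreducible_binomial K a u v ->
  (forall u' v', binomial K u' v' <> 0%R -> toric_ideal a (binomial K u' v') ->
          ~~ (binomial_supp u' v' \proper binomial_supp u v)) ->
  ('X^(m.+1) %| specialise i 'X_[u])%R.
Proof.
move=> m_low [/toric_binomialP uv disj gcd1] min_uv.
rewrite specialiseX; case: ifP => [/forall_inP u0|_]; last exact: dvdp0.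
have {}u0 j : j != i -> u j = 0 by move/u0/eqP.
apply: dvdp_exp2l.
have uE := @adeg_supp1 _ a _ _ u0.
have ui : 0 < u i.
  rewrite lt0n; apply/eqP => ui0; have v0 : v = 0%MM.
    by apply: (adeg_eq0 a_gt0); rewrite -uv uE ui0.
  move: gcd1; rewrite big1 // => j _; rewrite v0 mnm0E addn0.
  by have [->|/u0] := eqVneq j i.
have vi : v i = 0.
  by apply/eqP/negPn; move: (disjointFr disj (x := i)); rewrite !inE -lt0n ui => /(_ isT) ->.
have [j vj] : exists j, v j != 0.
  apply/existsP; rewrite -[X in is_true X]negbK negb_exists; apply/negP => /forallP v0.
  have : adeg a v = 0 by rewrite /adeg big1 // => j _; rewrite (eqP (negPn (v0 j))).
  by rewrite -uv uE => /eqP; rewrite muln_eq0 !gtn_eqF.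
have ji : j != i by apply: contraNneq vj => ->; rewrite vi.
have ij : i != j by rewrite eq_sym.
have vE : adeg a v = v j * tnth a j.
  apply: adeg_supp1 => k kj; apply/eqP/negPn/negP => vk.
  (* A third variable [k] in [v] would make the support of this toric binomial a
     proper subset of that of the circuit. *)
  suff : ~~ (binomial_supp (U_(i) *+ tnth a j) (U_(j) *+ tnth a i)
             \proper binomial_supp u v).
    move/negP; apply; apply/properP; split.
      apply: subset_trans (pair_supp i j _ _) _; apply/subsetP => l.
      by case/set2P => ->; rewrite !inE ?vj ?orbT // -lt0n ui.
    exists k; first by rewrite !inE vk orbT.
    apply/negP => /(subsetP (pair_supp i j _ _))/set2P[ki|kE].
      by rewrite ki vi in vk.
    by rewrite kE eqxx in kj.
  apply: min_uv.
  - apply: binomial_neq0; apply/eqP => /mnmP/(_ i)/eqP.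
    by rewrite !mulmnE !mnm1E eqxx (negPf ji) mul1n mul0n gtn_eqF.
  - by apply: toric_binomial; rewrite !adegU mulnC.
have lcm_ui : lcmn (tnth a i) (tnth a j) %| u i * tnth a i.
  by rewrite dvdn_lcm dvdn_mull //= -uE uv vE dvdn_mull.
have := leq_trans (m_low _ ji) (dvdn_leq _ lcm_ui).
by rewrite muln_gt0 ui a_gt0 ltn_pmul2r // => /(_ isT).
Qed.

(** If every such lcm exceeded [m * tnth a i], the specialisation would send each
    circuit, hence the whole toric ideal, to multiples of ['X^(m.+1)]; but it sends
    the binomial of the given relation to ['X^m]. *)
Lemma circuits_min_relation i m u : generated_by_circuits K a ->
  0 < m -> u i = 0 -> m * tnth a i = adeg a u ->
  exists2 j, j != i & lcmn (tnth a i) (tnth a j) <= m * tnth a i.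
Proof.
move=> gen m_gt0 ui mu.
have [/exists_inP[j ji le]|] := boolP [exists (j | j != i), lcmn (tnth a i) (tnth a j) <= m * tnth a i].
  by exists j.
rewrite negb_exists_in => /forall_inP low; exfalso.
have {}low j : j != i -> m * tnth a i < lcmn (tnth a i) (tnth a j).
  by move/low; rewrite -ltnNge.
have : ideal_span (circuit a) (binomial K (U_(i) *+ m) u).
  by apply/gen/toric_binomial; rewrite adegU.
have dvd p : ideal_span (circuit a) p -> ('X^(m.+1) %| specialise i p)%R.
  apply: (ideal_span_ind (P := fun p => ('X^(m.+1) %| specialise i p)%R)).
  - by rewrite /specialise rmorph0 dvdp0.
  - by move=> q r q0 r0; rewrite specialiseD dvdp_add.
  move=> c _ [u' [v' [-> [uvI disj gcd1] min_uv]]].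
  rewrite specialiseM dvdp_mull // specialiseB dvdp_sub //.
    exact: (circuit_monomial_low low _ min_uv).
  apply: (@circuit_monomial_low _ _ v' u' low).
    split; [|by rewrite disjoint_sym|by under eq_bigr do rewrite addnC].
    by apply/toric_binomialP/esym/toric_binomialP/uvI.
  by rewrite /binomial_supp setUC.
move/dvd; rewrite specialiseB !specialiseX.
have -> : [forall (j | j != i), (U_(i) *+ m)%MM j == 0].
  by apply/forall_inP => j ji; rewrite mulmnE mnm1E [i == j]eq_sym (negPf ji).
have -> : [forall (j | j != i), u j == 0] = false.
  apply: contraTF m_gt0 => /forall_inP u0; rewrite -eqn0Ngt.
  move: mu; rewrite (@adeg_supp1 _ _ _ i) => [|j /u0/eqP //].
  by rewrite ui mul0n => /eqP; rewrite muln_eq0 [X in _ || X]gtn_eqF ?orbF.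
rewrite subr0 mulmnE mnm1E eqxx mul1n => /dvdp_leq.
by rewrite -size_poly_eq0 !size_polyXn ltnn => /(_ isT).
Qed.

End Specialisation.

(** * Arithmetic of the minimal relations *)

(** Let [c = a1 / gcd(a1, a2)].  By Bezout, [gcd(a1, a2) * a3] is congruent modulo
    [a1] to a multiple [t * a2], and [t < c] can be had because [c * a2] is a multiple
    of [a1].  By [min2] such a [t * a2] does not exceed [gcd(a1, a2) * a3], and then
    [min3] applies to the multiple [gcd(a1, a2)] of [a3]. *)
Lemma eq_mul_gcdn a1 a2 a3 : 0 < a1 -> 0 < a2 -> 0 < a3 ->
  gcdn a1 (gcdn a2 a3) = 1 ->
  (forall t p q, 0 < t -> t * a2 = p * a1 + q * a3 -> lcmn a1 a2 <= t * a2) ->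
  (forall t p q, 0 < t -> t * a3 = p * a1 + q * a2 -> lcmn a1 a3 <= t * a3) ->
  a1 = gcdn a1 a2 * gcdn a1 a3.
Proof.
move=> a1_gt0 a2_gt0 a3_gt0 gcd1 min2 min3.
set g := gcdn a1 a2; set h := gcdn a1 a3.
have g_gt0 : 0 < g by rewrite gcdn_gt0 a1_gt0.
have h_gt0 : 0 < h by rewrite gcdn_gt0 a1_gt0.
have gh_a1 : g * h %| a1.
  rewrite Gauss_dvd ?dvdn_gcdl // /coprime -dvdn1 -gcd1 !dvdn_gcd.
  by rewrite (dvdn_trans (dvdn_gcdl _ _)) ?dvdn_gcdl //= (dvdn_trans (dvdn_gcdl _ _))
    ?(dvdn_trans (dvdn_gcdr _ _)) ?dvdn_gcdr.
apply/eqP; rewrite eqn_leq [X in _ && X]dvdn_leq // andbT.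
set c := a1 %/ g.
have aE : c * g = a1 by rewrite divnK ?dvdn_gcdl.
have c_gt0 : 0 < c by move: a1_gt0; rewrite -aE muln_gt0 => /andP[].
have lcm2 : lcmn a1 a2 = c * a2.
  apply/eqP; rewrite -(eqn_pmul2r g_gt0); have /= -> := muln_lcm_gcd a1 a2.
  by rewrite mulnAC aE.
have c_a2 : exists d, c * a2 = d * a1.
  by have /dvdnP[d dE] := dvdn_lcml a1 a2; exists d; rewrite -lcm2.
have [d dE] := c_a2.
have [km kn bez _] := egcdnP a1 a2_gt0.
have gE : gcdn a2 a1 = g by rewrite gcdnC.
rewrite gE in bez.
have [t [k [l [tc tE]]]] : exists t k l, t < c /\ t * a2 + k * a1 = g * a3 + l * a1.
  exists ((km * a3) %% c), ((km * a3) %/ c * d), (kn * a3); split; first exact: ltn_pmod.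
  rewrite -mulnA -dE mulnA -mulnDl addnC -divn_eq.
  have -> : km * a3 * a2 = km * a2 * a3 by ring.
  by rewrite bez; ring.
(* The sign of [k - l], the coefficient of [a1] in [g * a3], decides which
   minimality is used. *)
have [lk|kl] := leqP l k.
  have : g * a3 = (k - l) * a1 + t * a2 by nia.
  move/(min3 _ _ _ g_gt0).
  rewrite -(leq_pmul2r h_gt0) (muln_lcm_gcd a1 a3) => le.
  by rewrite -(leq_pmul2r a3_gt0) mulnAC.
have ta2 : t * a2 = (l - k) * a1 + g * a3 by nia.
have t_gt0 : 0 < t by rewrite lt0n; apply/eqP => t0; move: ta2; rewrite t0; nia.
by have := min2 _ _ _ t_gt0 ta2; rewrite lcm2 leq_pmul2r // leqNgt tc.
Qed.

(** * Minimal generating sets of submonoids of the natural numbers *)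

Section Semigroup.
Implicit Types (A B : {fset nat}).

Lemma monoid_span_mem A x : x \in A -> monoid_span A x.
Proof.
move=> xA; exists (fun y => y == x : nat); rewrite (big_fsetD1 x) //= eqxx mul1n.
rewrite big1_seq ?addn0 // => y /=; rewrite !inE => /andP[/negPf -> _]; exact: mul0n.
Qed.

Lemma monoid_spanD A s t : monoid_span A s -> monoid_span A t -> monoid_span A (s + t).
Proof.
move=> [c ->] [d ->]; exists (fun x => c x + d x).
by rewrite -big_split; apply: eq_bigr => x _; rewrite mulnDl.
Qed.

Lemma monoid_span0 A : monoid_span A 0.
Proof. by exists (fun=> 0); rewrite big1. Qed.

Lemma monoid_spanM A k s : monoid_span A s -> monoid_span A (k * s).
Proof.
move=> sA; elim: k => [|k IHk]; first exact: monoid_span0.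
by rewrite mulSn; apply: monoid_spanD.
Qed.

Lemma monoid_span_sub A B s :
  (forall x, x \in A -> monoid_span B x) -> monoid_span A s -> monoid_span B s.
Proof.
move=> AB [c ->]; rewrite big_seq; apply: (big_ind (monoid_span B)).
- exact: monoid_span0.
- exact: monoid_spanD.
by move=> x /AB; apply: monoid_spanM.
Qed.

(** A generator exceeding a number cannot occur in a representation of it. *)
Lemma monoid_span_lt A x s : s < x -> monoid_span A s -> monoid_span (A `\ x)%fset s.
Proof.
have [xA|xA] := boolP (x \in A); last by move=> _; rewrite mem_fsetD1.
move=> sx [c sE]; exists c; move: sE; rewrite (big_fsetD1 x) //=.
by case: (c x) => [|k]; nia.
Qed.

Variables (S : nat -> Prop).

(** An element that the others generate could be dropped. *)
Lemma minimal_notin_span A x :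
  minimal_generating_set S A -> x \in A -> ~ monoid_span (A `\ x)%fset x.
Proof.
move=> [SA min] xA x_span; apply: (min (A `\ x)%fset); first exact: fproperD1.
move=> s; rewrite SA; split; apply: monoid_span_sub => y.
  by move=> yA; have [->//|yx] := eqVneq y x; apply: monoid_span_mem; rewrite !inE yx.
by rewrite !inE => /andP[_]; apply: monoid_span_mem.
Qed.

Lemma minimal_gt0 A x : minimal_generating_set S A -> x \in A -> 0 < x.
Proof.
move=> min xA; rewrite lt0n; apply/eqP => x0; apply: (minimal_notin_span min xA).
by rewrite x0; apply: monoid_span0.
Qed.

(** A minimal generator [x] is irreducible: the parts of a sum of two smaller
    elements are generated without [x].  So when [x] is written over another
    generating set, some generator [b] occurs in it and leaves remainder zero. *)
Lemma minimal_sub_generating A B :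
  minimal_generating_set S A -> generates B S -> (A `<=` B)%fset.
Proof.
move=> min SB; apply/fsubsetP => x xA; have x_gt0 := minimal_gt0 min xA.
have SA := min.1; have [c xE] : monoid_span B x by apply/SB/SA/monoid_span_mem.
have [b bB cb] : exists2 b, b \in B & 0 < c b * b.
  apply/hasP; apply: contraLR x_gt0 => /hasPn c0; rewrite xE big1_seq // => b /= /c0.
  by rewrite -eqn0Ngt => /eqP.
move: cb; rewrite muln_gt0 => /andP[cb b_gt0].
have Ab : monoid_span A b by apply/SA/SB/monoid_span_mem.
have [r rE] : exists r, x = b + r.
  exists (x - b); rewrite subnKC // xE (big_fsetD1 b) //=.
  by apply: leq_trans (leq_addr _ _); rewrite leq_pmull.
have Ar : monoid_span A r.
  apply/SA/SB; exists (fun y => if y == b then (c b).-1 else c y).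
  move: xE; rewrite rE !(big_fsetD1 b bB) /= eqxx => xE.
  rewrite (eq_big_seq (fun y => c y * y)) => [|y]; last first.
    by rewrite !inE => /andP[/negPf ->].
  by apply/eqP; rewrite -(eqn_add2l b) xE addnA -mulSn prednK.
have [r0|r_gt0] := posnP r; first by rewrite rE r0 addn0.
exfalso; apply: (minimal_notin_span min xA); rewrite {2}rE; apply: monoid_spanD.
  by apply: monoid_span_lt Ab; lia.
by apply: monoid_span_lt Ar; lia.
Qed.

Lemma minimal_generating_set_uniq A B :
  minimal_generating_set S A -> minimal_generating_set S B -> A = B.
Proof.
move=> minA minB; apply/eqP; rewrite eqEfsubset.
by rewrite (minimal_sub_generating minA minB.1) (minimal_sub_generating minB minA.1).
Qed.

Lemma numerical_semigroup_gcd A d : numerical_semigroup S -> generates A S ->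
  (forall x, x \in A -> d %| x) -> d = 1.
Proof.
move=> [B [_ gcdB SB]] SA dA; apply/eqP; rewrite -dvdn1 -gcdB big_seq.
apply: (big_ind (dvdn d)) => [|x y dx dy|x xB]; first exact: dvdn0.
  by rewrite dvdn_gcd dx.
have [c ->] : monoid_span A x by apply/SA/SB/monoid_span_mem.
by rewrite big_seq; apply: dvdn_sum => y /dA /dvdn_mull.
Qed.

End Semigroup.

(** * Three variables *)

Lemma enum3 (i j k : 'I_3) : uniq [:: i; j; k] -> perm_eq (enum 'I_3) [:: i; j; k].
Proof.
move=> u; rewrite perm_sym uniq_perm ?enum_uniq //.
have [| |//] := uniq_min_size (s2 := enum 'I_3) u => [x _|]; first by rewrite mem_enum.
by rewrite size_enum_ord.
Qed.

Lemma monomial3 (i j k : 'I_3) (u : 'X_{1..3}) : uniq [:: i; j; k] ->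
  u = (U_(i) *+ u i + (U_(j) *+ u j + U_(k) *+ u k))%MM.
Proof.
move=> uq; apply/mnmP => l; rewrite !mnmDE !mulmnE !mnm1E.
have := perm_mem (enum3 uq) l; rewrite mem_enum inE => /esym.
move: uq; rewrite /= !inE negb_or andbT => /andP[/andP[ij ik] jk].
case/or3P => /eqP ->; rewrite ?eqxx.
- by rewrite ![_ == i]eq_sym (negPf ij) (negPf ik) mul1n !mul0n !addn0.
- by rewrite (negPf ij) [_ == j]eq_sym (negPf jk) mul1n !mul0n addn0.
- by rewrite (negPf ik) (negPf jk) mul1n !mul0n.
Qed.

Lemma residue_inj d c y y' x x' : coprime d c -> y < d -> y' < d ->
  x * d + y * c = x' * d + y' * c -> y = y'.
Proof.
move=> co; wlog le : x x' y y' / y <= y' => [wlog_le yd yd' E|yd yd' E].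
  have [le|/ltnW le] := leqP y y'; first exact: wlog_le E.
  by apply/esym; apply: wlog_le (esym E).
have : d %| y' - y.
  rewrite -(Gauss_dvdl _ co) mulnBl -eqn_mod_dvd ?leq_mul2r ?le ?orbT //.
  by have /(congr1 (modn^~ d)) := E; rewrite !modnMDl => ->.
by have [|pos /(dvdn_leq pos)] := posnP (y' - y); lia.
Qed.

Section ThreeVariables.
Variables (K : fieldType) (a : 3.-tuple nat).
Hypothesis a_gt0 : forall i, 0 < tnth a i.

(** That [d2] is prime to [f2], [d1] and [d3] serves twice: it makes
    [x_i^(f2 d1) - x_j^(d2)] a circuit, and it lets the degree modulo [d2] recover
    the exponent of [x_j] in a reduced monomial.  Likewise for [d3] and [x_k]. *)
Lemma gluing_generated_by_circuits (i j k : 'I_3) d1 d2 d3 f2 f3 :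
  uniq [:: i; j; k] ->
  coprime d1 d2 -> coprime d1 d3 -> coprime d2 d3 -> coprime d2 f2 -> coprime d3 f3 ->
  tnth a i = d2 * d3 -> tnth a j = f2 * d1 * d3 -> tnth a k = f3 * d1 * d2 ->
  generated_by_circuits K a.
Proof.
move=> uq co12 co13 co23 cof2 cof3 ai aj ak.
have [d2_gt0 d3_gt0] : 0 < d2 /\ 0 < d3.
  by apply/andP; rewrite -muln_gt0 -ai a_gt0.
have [/andP[ij ik] jk] : (i != j) && (i != k) /\ j != k.
  by move: uq; rewrite /= !inE negb_or andbT => /andP.
apply: generated_by_circuitsP => u v uv; pose G := circuit (K := K) a.
have Gij : congruent G (U_(i) *+ (f2 * d1)) (U_(j) *+ d2).
  apply/ideal_span_gen/circuit_pair => //; first by rewrite ai aj; ring.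
  by rewrite coprimeMl co12 coprime_sym cof2.
have Gik : congruent G (U_(i) *+ (f3 * d1)) (U_(k) *+ d3).
  apply/ideal_span_gen/circuit_pair => //; first by rewrite ai ak; ring.
  by rewrite coprimeMl co13 coprime_sym cof3.
pose x (w : 'X_{1..3}) := w i + (w j %/ d2 * (f2 * d1) + w k %/ d3 * (f3 * d1)).
pose nf w := (U_(i) *+ x w + (U_(j) *+ (w j %% d2) + U_(k) *+ (w k %% d3)))%MM.
have nfP w : congruent G w (nf w).
  rewrite {1}(monomial3 w uq).
  have := congruentD (congruent_refl G (U_(i) *+ w i))
    (congruentD (congruent_divn (w j) Gij) (congruent_divn (w k) Gik)).
  congr (congruent _ _ _); apply/mnmP => l; rewrite !mnmDE !mulmnE /x; ring.
suff nf_uv : nf u = nf v.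
  by apply: congruent_trans (nfP u) _; rewrite nf_uv; apply: congruent_sym.
have adeg_nf w : adeg a (nf w) = x w * (d2 * d3) +
    (w j %% d2 * (f2 * d1 * d3) + w k %% d3 * (f3 * d1 * d2)).
  by rewrite !adegD !adegU ai aj ak.
have nf_deg w : adeg a w = adeg a (nf w).
  exact/(toric_binomialP K)/circuit_toric/nfP.
have E : adeg a (nf u) = adeg a (nf v) by rewrite -!nf_deg.
have Ej : u j %% d2 = v j %% d2.
  apply: (@residue_inj d2 (f2 * d1 * d3) _ _
    (x u * d3 + u k %% d3 * (f3 * d1)) (x v * d3 + v k %% d3 * (f3 * d1))).
  - by rewrite !coprimeMr cof2 co23 coprime_sym co12.
  - exact: ltn_pmod.
  - exact: ltn_pmod.
  by transitivity (adeg a (nf u)); [|rewrite E]; rewrite adeg_nf; ring.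
have Ek : u k %% d3 = v k %% d3.
  apply: (@residue_inj d3 (f3 * d1 * d2) _ _
    (x u * d2 + u j %% d2 * (f2 * d1)) (x v * d2 + v j %% d2 * (f2 * d1))).
  - by rewrite !coprimeMr cof3 [coprime d3 d1]coprime_sym co13 coprime_sym co23.
  - exact: ltn_pmod.
  - exact: ltn_pmod.
  by transitivity (adeg a (nf u)); [|rewrite E]; rewrite adeg_nf; ring.
move/eqP: E; rewrite !adeg_nf Ej Ek eqn_add2r eqn_pmul2r -?ai // => /eqP Ei.
by rewrite /nf Ei Ej Ek.
Qed.

Lemma max_pair (F : 'I_3 -> 'I_3 -> nat) : (forall i j, F i j = F j i) ->
  exists i j k, [/\ uniq [:: i; j; k], F i j <= F j k & F i k <= F j k].
Proof.
move=> FC; pose o0 : 'I_3 := @Ordinal 3 0 isT; pose o1 : 'I_3 := @Ordinal 3 1 isT.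
pose o2 : 'I_3 := @Ordinal 3 2 isT.
have [le1|/ltnW le1] := leqP (F o0 o1) (F o0 o2).
  have [le2|/ltnW le2] := leqP (F o0 o2) (F o1 o2).
    by exists o0, o1, o2; rewrite le2 (leq_trans le1 le2).
  by exists o1, o0, o2; rewrite FC le1 le2.
have [le2|/ltnW le2] := leqP (F o0 o1) (F o1 o2).
  by exists o0, o1, o2; rewrite le2 (leq_trans le1 le2).
by exists o2, o0, o1; rewrite FC le1 FC le2.
Qed.

(** With [lcm a_j a_k] the largest of the three lcms, the alternative in
    [circuits_min_relation] always yields the lcm with [a_i], for both [j] and [k]. *)
Lemma generated_by_circuits_gcd : generated_by_circuits K a ->
  (forall d, (forall i, d %| tnth a i) -> d = 1) ->
  exists i j k, [/\ uniq [:: i; j; k],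
    tnth a i = gcdn (tnth a i) (tnth a j) * gcdn (tnth a i) (tnth a k)
    & gcdn (tnth a i) (gcdn (tnth a j) (tnth a k)) = 1].
Proof.
move=> gen gcd1.
have [i [j [k [uq leij leik]]]] :=
  max_pair (F := fun i j => lcmn (tnth a i) (tnth a j)) (fun i j => lcmnC _ _).
have [/andP[ij ik] jk] : (i != j) && (i != k) /\ j != k.
  by move: uq; rewrite /= !inE negb_or andbT => /andP.
have all3 l : [|| l == i, l == j | l == k].
  by have := perm_mem (enum3 uq) l; rewrite mem_enum !inE => /esym.
have gcd_ijk : gcdn (tnth a i) (gcdn (tnth a j) (tnth a k)) = 1.
  apply: gcd1 => l; case/or3P: (all3 l) => /eqP->.
  - exact: dvdn_gcdl.
  - by rewrite (dvdn_trans (dvdn_gcdr _ _)) ?dvdn_gcdl.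
  - by rewrite (dvdn_trans (dvdn_gcdr _ _)) ?dvdn_gcdr.
exists i, j, k; split=> //; apply: eq_mul_gcdn => // t p q t_gt0 tE.
  have [||l lj] := circuits_min_relation (i := j) (u := U_(i) *+ p + U_(k) *+ q) a_gt0 gen t_gt0.
  - by rewrite mnmDE !mulmnE !mnm1E (negPf ij) eq_sym (negPf jk).
  - by rewrite adegD !adegU.
  case/or3P: (all3 l) lj => /eqP->; rewrite ?eqxx // => _; first by rewrite lcmnC.
  exact: leq_trans.
have [||l lk] := circuits_min_relation (i := k) (u := U_(i) *+ p + U_(j) *+ q) a_gt0 gen t_gt0.
- by rewrite mnmDE !mulmnE !mnm1E (negPf ik) (negPf jk).
- by rewrite adegD !adegU.
case/or3P: (all3 l) lk => /eqP->; rewrite ?eqxx // => _; first by rewrite lcmnC.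
by rewrite lcmnC; apply: leq_trans.
Qed.

End ThreeVariables.

Theorem proposition3p26 (K : fieldType) (S : nat -> Prop)
    (A : {fset nat}) (a : 3.-tuple nat)
    (hS : numerical_semigroup S)
    (hdim : has_embedding_dimension S 3)
    (hA : minimal_generating_set S A)
    (ha : enumerates a A) :
  generated_by_circuits K a <->
  exists d1 d2 d3 f2 f3 : nat,
    [/\ [/\ 0 < d1, 0 < d2, 0 < d3, 0 < f2 & 0 < f3],
        [/\ coprime d1 d2, coprime d1 d3 & coprime d2 d3],
        coprime d2 f2 /\ coprime d3 f3
      & minimal_generating_set S
          [fset d2 * d3; f2 * d1 * d3; f3 * d1 * d2]%fset].
Proof.
have [a_uniq memA] := ha.
have a_gt0 i : 0 < tnth a i by apply: (minimal_gt0 hA); rewrite memA mem_tnth.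
split=> [gen|[d1 [d2 [d3 [f2 [f3 [_ [co12 co13 co23] [cof2 cof3] minB]]]]]]].
  have [|i [j [k [uq]]]] := generated_by_circuits_gcd a_gt0 gen.
    move=> d da; apply: (numerical_semigroup_gcd hS hA.1) => x.
    by rewrite memA => /tnthP[i ->].
  set g := gcdn _ (tnth a j); set h := gcdn _ (tnth a k) => aiE gcd1.
  have g_gt0 : 0 < g by rewrite gcdn_gt0 a_gt0.
  have h_gt0 : 0 < h by rewrite gcdn_gt0 a_gt0.
  have ajE : tnth a j %/ g * g = tnth a j by rewrite divnK ?dvdn_gcdr.
  have akE : tnth a k %/ h * h = tnth a k by rewrite divnK ?dvdn_gcdr.
  (* [d1 = 1] suffices: common factors of [a_j] and [a_k] can stay in [f2] and [f3]. *)
  exists 1, h, g, (tnth a j %/ g), (tnth a k %/ h); rewrite !muln1 ajE akE mulnC -aiE.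
  split.
  - by split=> //; rewrite divn_gt0 // dvdn_leq ?dvdn_gcdr.
  - split; rewrite ?coprime1n // /coprime -dvdn1 -gcd1 !dvdn_gcd.
    rewrite (dvdn_trans (dvdn_gcdl _ _)) ?dvdn_gcdl //=.
    by rewrite (dvdn_trans (dvdn_gcdr _ _)) ?dvdn_gcdr //= (dvdn_trans (dvdn_gcdl _ _)) ?dvdn_gcdr.
  - split; rewrite /coprime.
      by rewrite -(eqn_pmul2r g_gt0) muln_gcdl ajE mulnC -aiE mul1n.
    by rewrite -(eqn_pmul2r h_gt0) muln_gcdl akE -aiE mul1n.
  rewrite (_ : [fset _; _; _]%fset = A) //; apply/fsetP => x; rewrite memA !inE -orbA.
  have := perm_mem (perm_map (tnth a) (enum3 uq)) x.
  by rewrite map_tnth_enum /= !inE => ->.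
have AB := minimal_generating_set_uniq hA minB.
have sub x : (x \in a) = (x \in [:: d2 * d3; f2 * d1 * d3; f3 * d1 * d2]).
  by rewrite -memA AB !inE -orbA.
have uB : uniq [:: d2 * d3; f2 * d1 * d3; f3 * d1 * d2].
  by apply: (leq_size_uniq a_uniq) => [x|]; rewrite ?sub ?size_tuple.
have /tnthP[i ai] : d2 * d3 \in a by rewrite sub !inE eqxx.
have /tnthP[j aj] : f2 * d1 * d3 \in a by rewrite sub !inE eqxx orbT.
have /tnthP[k ak] : f3 * d1 * d2 \in a by rewrite sub !inE eqxx !orbT.
apply: (gluing_generated_by_circuits (i := i) (j := j) (k := k) _ _ co12 co13 co23 cof2 cof3) => //.
by apply: (@map_uniq _ _ (tnth a)); rewrite /= -ai -aj -ak.
Qed.
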